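(* Let $\theta_1$ and $\theta_2$ be $\mu$-preserving Borel actions of $\mathbb F_\infty$ on $X=\{0,1\}^{\mathbb N}$ which are measured orbit equivalent, i.e. for $\mu$-almost every $x\in X$ the orbits $\theta_1(\mathbb F_\infty,x)$ and $\theta_2(\mathbb F_\infty,x)$ coincide (so both actions generate the same measured equivalence relation). If $\theta_1$ is sofic, then $\theta_2$ is sofic. Consequently, soficity is a property of the measured equivalence relation rather than of the particular generating action.
   Context: Let $X=\{0,1\}^{\mathbb N}$ with $\mu$ the product of the uniform measures on $\{0,1\}$. Let $\mathbb F_\infty$ be the free group on generators $\gamma_1,\gamma_2,\dots$. For $r\ge 0$ let $W_r\subset\mathbb F_\infty$ be the set of reduced words of length at most $r$ in the letters $\gamma_1^{\pm1},\dots,\gamma_r^{\pm1}$. A labelled finite set is a finite set $Y$ together with a map assigning to each $y\in Y$ a label in $\{0,1\}^{\mathbb N}$; points of $X$ are labelled by themselves. For an action $\theta$ of $\mathbb F_\infty$ (on $X$ or on a labelled finite set) and a point $x$, the $r$-labelled $r$-neighbourhood $B^r_r(x)$ is the rooted directed multigraph with vertex set $\theta(W_r,x)$ and root $x$, having, for each vertex $y$, each $i\le r$ and each $\epsilon\in\{1,-1\}$ with $\theta(\gamma_i^{\epsilon},y)$ in the vertex set, a directed edge from $y$ to $\theta(\gamma_i^\epsilon,y)$ coloured $\gamma_i^\epsilon$ (loops and multiple edges allowed), and in which each vertex carries as label the first $r$ digits of its label. Let $U^{r,r}$ be the finite set of isomorphism classes of such objects (isomorphisms preserving root, colours and labels).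 For $\alpha\in U^{r,r}$ put $T(\theta,\alpha)=\{x: B^r_r(x)\cong\alpha\}$ and $p_\alpha(\theta)=\mu(T(\theta,\alpha))$ for a Borel action on $X$, resp. $p_\alpha(\theta)=|T(\theta,\alpha)|/|Y|$ for an action on a labelled finite set $Y$. A Borel action $\theta$ of $\mathbb F_\infty$ on $X$ is sofic if there exist actions $\theta_n$ of $\mathbb F_\infty$ on labelled finite sets $Y_n$ such that $\lim_{n\to\infty}p_\alpha(\theta_n)=p_\alpha(\theta)$ for every $r\ge1$ and every $\alpha\in U^{r,r}$. *)

(* Defs.v *)
From HB Require Import structures.
From mathcomp Require Import all_boot all_order all_algebra.
From mathcomp Require Import all_classical all_reals all_analysis.
From mathcomp Require Import fingroup perm.
Set Implicit Arguments. Unset Strict Implicit. Unset Printing Implicit Defensive.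
Import Order.TTheory GRing.Theory Num.Theory.
Local Open Scope classical_set_scope.
Local Open Scope ring_scope.

Definition Xspace : Type := g_sigma_algebraType (@open cantor_space).
HB.instance Definition _ := Pointed.on Xspace.

(* mu is the product of the uniform measures on {0,1}: it is the (unique)
   probability measure on the Borel sets of X giving every cylinder set
   determined by the first n coordinates the mass 2^-n. *)
Definition is_coin_product (R : realType) (mu : set Xspace -> \bar R) : Prop :=
  forall (n : nat) (s : nat -> bool),
    mu [set x : Xspace | forall i, (i < n)%N -> x i = s i] = ((2%:R ^- n : R)%:E).

(* Letters of F_oo: (i, true) = gamma_(i+1), (i, false) = gamma_(i+1)^-1
   (generators are indexed from 0 here). Words are sequences of letters. *)
Definition letter := (nat * bool)%type.
Definition word := seq letter.

Fixpoint reduced (w : word) : bool :=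
  match w with
  | a :: ((b :: _) as w') => ~~ ((a.1 == b.1) && (a.2 != b.2)) && reduced w'
  | _ => true
  end.

Definition in_W (r : nat) (w : word) : bool :=
  [&& reduced w, (size w <= r)%N & all (fun a : letter => (a.1 < r)%N) w].

(* An action of F_oo on a type Y is given by the action of each letter:
   act i true = action of gamma_(i+1), act i false = action of its inverse.
   A word acts by composition: the word a1 a2 ... an sends y to a1(a2(...an(y))). *)
Definition act_word (Y : Type) (act : nat -> bool -> Y -> Y) (w : word) (y : Y) : Y :=
  foldr (fun a z => act a.1 a.2 z) y w.

Definition is_action (Y : Type) (act : nat -> bool -> Y -> Y) : Prop :=
  forall i, cancel (act i true) (act i false) /\ cancel (act i false) (act i true).

Definition nbhd_vertices (Y : Type) (act : nat -> bool -> Y -> Y) (r : nat) (x : Y) : set Y :=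
  [set y | exists w : word, in_W r w /\ y = act_word act w x].

Definition F_orbit (Y : Type) (act : nat -> bool -> Y -> Y) (x : Y) : set Y :=
  [set y | exists w : word, y = act_word act w x].

(* An abstract r-labelled rooted edge-coloured directed multigraph in which every
   vertex has at most one outgoing edge of each colour gamma_i^eps (i <= r): vertices
   'I_pk, root, the (optional) target of the edge of colour (i, eps) out of v,
   and labels in {0,1}^r. Isomorphism classes of B^r_r(x) are the classes of these. *)
Record pattern (r : nat) := Pattern {
  pk : nat;
  proot : 'I_pk;
  pnbr : 'I_pk -> 'I_r -> bool -> option 'I_pk;
  plab : 'I_pk -> 'I_r -> bool }.
Arguments pk {r} p.
Arguments proot {r} p.
Arguments pnbr {r} p _ _ _.
Arguments plab {r} p _ _.

Definition nbhd_iso (Y : Type) (act : nat -> bool -> Y -> Y) (lab : Y -> nat -> bool)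
    (r : nat) (x : Y) (alpha : pattern r) : Prop :=
  exists phi : 'I_(pk alpha) -> Y,
    [/\ injective phi,
        (forall y, nbhd_vertices act r x y <-> exists v, phi v = y),
        phi (proot alpha) = x,
        (forall v (i : 'I_r) (e : bool),
           match pnbr alpha v i e with
           | Some w => phi w = act i e (phi v)
           | None => ~ nbhd_vertices act r x (act i e (phi v))
           end) &
        (forall v (j : 'I_r), plab alpha v j = lab (phi v) j)].

Definition Tset (Y : Type) (act : nat -> bool -> Y -> Y) (lab : Y -> nat -> bool)
    (r : nat) (alpha : pattern r) : set Y :=
  [set x | nbhd_iso act lab x alpha].

Definition p_fin (R : realType) (Y : finType) (act : nat -> bool -> Y -> Y)
    (lab : Y -> nat -> bool) (r : nat) (alpha : pattern r) : R :=
  (#|[set y : Y | `[< Tset act lab alpha y >]]|%:R / #|Y|%:R).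

Definition perm_act (Y : finType) (s : nat -> {perm Y}) : nat -> bool -> Y -> Y :=
  fun i e y => if e then s i y else (s i)^-1%g y.

Definition sofic (R : realType) (mu : set Xspace -> \bar R)
    (act : nat -> bool -> Xspace -> Xspace) : Prop :=
  exists (Y : nat -> finType) (lab : forall n, Y n -> nat -> bool)
         (s : forall n, nat -> {perm Y n}),
    forall (r : nat) (alpha : pattern r), (1 <= r)%N ->
      ((fun n => (p_fin R (perm_act (s n)) (lab n) alpha)%:E) @ \oo
        --> mu (Tset act id alpha))%E.

Definition mp_borel_action (R : realType) (mu : set Xspace -> \bar R)
    (act : nat -> bool -> Xspace -> Xspace) : Prop :=
  is_action act /\
  forall i e, measurable_fun setT (act i e) /\
    forall A : set Xspace, measurable A -> mu (act i e @^-1` A) = mu A.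

(* Main.v *)
(* Since the orbits agree, each generator of theta2 moves x to theta1(w, x) for a
   word w depending measurably on x. Up to a set of small measure, w takes finitely
   many values and depends on finitely many digits of x. Such a rule makes sense on
   every labelled finite model of theta1, and the events "the rules for gamma_i and
   gamma_i^-1 are inverse to each other at y" and "the rules produce a given
   theta2-ball at y" depend only on a theta1-ball of y, so their frequencies are close
   to the corresponding measures. Hence on the finite model the rules are almost
   mutually inverse; they agree with permutations off a small set, and the local
   statistics of these permutations approximate those of theta2. *)
Require Import Defs.
From HB Require Import structures.
From mathcomp Require Import all_boot all_order all_algebra.
From mathcomp Require Import all_classical all_reals all_analysis.
From mathcomp Require Import fingroup perm ring.
Set Implicit Arguments. Unset Strict Implicit. Unset Printing Implicit Defensive.
Import Order.TTheory GRing.Theory Num.Theory numFieldNormedType.Exports.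
Local Open Scope classical_set_scope.
Local Open Scope ring_scope.

(** * Neighbourhoods and finitely many tests *)

Lemma act_letterK (Y : Type) (act : nat -> bool -> Y -> Y) (i : nat) (e : bool) :
  is_action act -> cancel (act i e) (act i (~~ e)).
Proof. by move=> /(_ i)[]; case: e. Qed.

Lemma act_word_cons (Y : Type) (act : nat -> bool -> Y -> Y) (a : letter) (w : word) (y : Y) :
  act_word act (a :: w) y = act a.1 a.2 (act_word act w y).
Proof. by []. Qed.

Lemma act_word_cat (Y : Type) (act : nat -> bool -> Y -> Y) (u v : word) (y : Y) :
  act_word act (u ++ v) y = act_word act u (act_word act v y).
Proof. by rewrite /act_word foldr_cat. Qed.

(** Free reduction, one letter at a time: a new letter either cancels the head of the reduced tail
    or is put in front of it, so neither length nor alphabet grows. *)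
Lemma reduced_word_exists (Y : Type) (act : nat -> bool -> Y -> Y) (w : word)
    (p : pred letter) : is_action act -> all p w ->
  exists w', [/\ reduced w', (size w' <= size w)%N, all p w' &
                 act_word act w' =1 act_word act w].
Proof.
move=> hact; elim: w => [|[i e] w IH] /=; first by move=> _; exists [::].
case/andP=> pl /IH[[|[j e'] w'] [red sz pw E]].
  by exists [:: (i, e)]; split => //= [|y]; rewrite ?pl // !act_word_cons -E.
case: (boolP ((i == j) && (e != e'))) => [/andP[/eqP ij ee]|ne].
  exists w'; split.
  - by case: w' red {sz pw E} => //= b w' /andP[].
  - by rewrite ltnW // ltnS ltnW.
  - by case/andP: pw.
  - move=> y; rewrite act_word_cons -E /= ij.
    have -> : e' = ~~ e by case: (e) (e') ee => [] [].
    by rewrite -{1}(negbK e) (act_letterK _ _ hact).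
exists [:: (i, e), (j, e') & w']; split => //=.
- by rewrite /= in red; rewrite red ne.
- by rewrite pl.
- by move=> y; rewrite act_word_cons -E.
Qed.

(** Reducedness is dropped from [in_W]: the same points are reached, and such words can be
    concatenated freely. *)
Definition in_words (r : nat) (w : word) : bool :=
  (size w <= r)%N && all (fun a : letter => (a.1 < r)%N) w.

Definition letters (r : nat) : seq letter :=
  [seq (i, e) | i <- iota 0 r, e <- [:: true; false]].

Lemma mem_letters (r : nat) (a : letter) : (a \in letters r) = (a.1 < r)%N.
Proof.
case: a => i e; apply/allpairsP/idP => [[[j f] [/= jr _ [-> _]]]|/= ir].
  by rewrite mem_iota in jr.
by exists (i, e); split => //=; [rewrite mem_iota|case: e].
Qed.

Fixpoint words (r k : nat) : seq word :=
  if k is k'.+1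
  then [::] :: [seq a :: w | a <- letters r, w <- words r k']
  else [:: [::]].

Lemma mem_words (r k : nat) (w : word) :
  (w \in words r k) = (size w <= k)%N && all (fun a : letter => (a.1 < r)%N) w.
Proof.
elim: k w => [|k IH] [|[i e] w] //=; rewrite in_cons /=.
rewrite ltnS andbCA -IH -(mem_letters r (i, e)).
apply/allpairsP/andP => [[[a w'] /= [al ww' [-> ->]]] //|[al ww']].
by exists ((i, e), w).
Qed.

Lemma words_ball (r : nat) (w : word) : (w \in words r r) = in_words r w.
Proof. exact: mem_words. Qed.

Lemma nbhd_vertices_words (Y : Type) (act : nat -> bool -> Y -> Y) (r : nat) (x y : Y) :
  is_action act ->
  nbhd_vertices act r x y <-> exists2 w, in_words r w & y = act_word act w x.
Proof.
move=> hact; split => [[w [/and3P[_ sz al] ->]]|[w /andP[sz al] ->]].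
  by exists w => //; rewrite /in_words sz.
have [w' [red sz' al' E]] := reduced_word_exists hact al.
by exists w'; split; rewrite ?E // /in_W red al' (leq_trans sz').
Qed.

Arguments words : simpl never.

(* [inl (u, v)] tests whether u and v move the point to the same place,
   [inr (u, j)] reads digit j of the label of the point reached by u. *)
Definition test : Type := ((word * word) + (word * nat))%type.

Definition passes (Y : Type) (act : nat -> bool -> Y -> Y) (lab : Y -> nat -> bool)
    (y : Y) (k : test) : bool :=
  match k with
  | inl p => `[< act_word act p.1 y = act_word act p.2 y >]
  | inr p => lab (act_word act p.1 y) p.2
  end.

(* The words of length r.+1 record the edges leaving the vertices at distance r. *)
Definition ball_tests (r : nat) : seq test :=
  [seq inl (w, w') | w <- words r r.+1, w' <- words r r] ++
  [seq inr (w, j) | w <- words r r, j <- iota 0 r].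

Definition ball_test (r : nat) (k : test) : bool :=
  match k with
  | inl p => [&& (size p.1 <= r.+1)%N, all (fun a : letter => (a.1 < r)%N) p.1
               & in_words r p.2]
  | inr p => in_words r p.1 && (p.2 < r)%N
  end.

Lemma mem_ball_tests (r : nat) (k : test) : (k \in ball_tests r) = ball_test r k.
Proof.
rewrite mem_cat; apply/orP/idP.
  case=> /allpairsP[[w w'] /= [h h' ->]] /=.
    by rewrite -words_ball h' andbT -mem_words.
  by rewrite -words_ball h; rewrite mem_iota in h'.
case: k => -[w w'] h; [left|right]; apply/allpairsP; exists (w, w'); split => //.
- by rewrite mem_words; case/and3P: h => -> ->.
- by rewrite words_ball; case/and3P: h.
- by rewrite words_ball; case/andP: h.
- by rewrite mem_iota; case/andP: h.
Qed.

Definition ball_equiv (r : nat) (Y Z : Type) actY labY actZ labZ (y : Y) (z : Z) : Prop :=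
  {in ball_tests r, passes actY labY y =1 passes actZ labZ z}.

(* A property of a point of a labelled action, given uniformly over all actions,
   so that the same statistic can be read on X and on finite models. *)
Definition local_statistic : Type :=
  forall Y : Type, (nat -> bool -> Y -> Y) -> (Y -> nat -> bool) -> Y -> Prop.

Definition is_local (r : nat) (Q : local_statistic) : Prop :=
  forall (Y Z : Type) actY labY actZ labZ (y : Y) (z : Z),
    is_action actY -> is_action actZ ->
    ball_equiv r actY labY actZ labZ y z ->
    Q Y actY labY y -> Q Z actZ labZ z.

Lemma in_words_cons (r : nat) (i : nat) (e : bool) (w : word) :
  in_words r ((i, e) :: w) -> (i < r)%N /\ in_words r w.
Proof. by case/andP=> /= sz /andP[-> al]; split=> //; rewrite /in_words al ltnW. Qed.

Lemma ball_tests_mono (r r' : nat) : (r <= r')%N ->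
  {subset ball_tests r <= ball_tests r'}.
Proof.
move=> rr k; rewrite !mem_ball_tests.
have mono w n n' : (n <= n')%N ->
    (size w <= n)%N && all (fun a : letter => (a.1 < r)%N) w ->
    (size w <= n')%N && all (fun a : letter => (a.1 < r')%N) w.
  move=> nn /andP[sz al]; rewrite (leq_trans sz) //=.
  by apply: sub_all al => a /leq_trans; exact.
case: k => -[w w'] /=.
  case/and3P=> su au h2; have h1 : (size w <= r.+1)%N && all (fun a : letter => (a.1 < r)%N) w.
    by rewrite su.
  by rewrite andbA (mono _ _ r'.+1 _ h1) //; exact: mono h2.
by case/andP=> h1 jr; rewrite (leq_trans jr rr) andbT; exact: mono h1.
Qed.

Lemma ball_equiv_leq (r r' : nat) (Y Z : Type) actY labY actZ labZ (y : Y) (z : Z) :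
  (r <= r')%N -> ball_equiv r' actY labY actZ labZ y z ->
  ball_equiv r actY labY actZ labZ y z.
Proof. by move=> rr h k /(ball_tests_mono rr); exact: h. Qed.

Lemma is_local_mono (r r' : nat) (Q : local_statistic) : (r <= r')%N ->
  is_local r Q -> is_local r' Q.
Proof.
move=> rr lQ Y Z aY lY aZ lZ y z hY hZ E; apply: lQ hY hZ _.
exact: ball_equiv_leq rr E.
Qed.

(** Each vertex [v] of the pattern is reached from [y] by a word [c v]; the same words read from [z]
    give the isomorphism there. All its conditions are outcomes of tests, and an edge of the ball is
    tested by a word of length up to [r.+1]. *)
Lemma nbhd_iso_local (r : nat) (alpha : pattern r) :
  is_local r (fun Y act lab y => Tset act lab alpha y).
Proof.
move=> Y Z aY lY aZ lZ y z hY hZ E [phi [inj vert root edge labs]].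
have Eeq u w : (size u <= r.+1)%N -> all (fun a : letter => (a.1 < r)%N) u ->
    in_words r w ->
    (act_word aY u y = act_word aY w y <-> act_word aZ u z = act_word aZ w z).
  move=> su au rw; have /= := E (inl (u, w)).
  rewrite mem_ball_tests /= su au rw => /(_ isT) h.
  by split=> ?; apply/asboolP; [rewrite -h|rewrite h]; apply/asboolP.
have Eeq' u w : in_words r u -> in_words r w ->
    (act_word aY u y = act_word aY w y <-> act_word aZ u z = act_word aZ w z).
  by case/andP=> su au; apply: Eeq => //; rewrite ltnW.
have /choice[c hc] : forall v, exists w, in_words r w /\ phi v = act_word aY w y.
  move=> v; have /(nbhd_vertices_words _ _ _ hY)[w rw E'] : nbhd_vertices aY r y (phi v).
    by apply/vert; exists v.
  by exists w.
have rc v : in_words r (c v) by have [] := hc v.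
have pc v : phi v = act_word aY (c v) y by have [] := hc v.
exists (fun v => act_word aZ (c v) z); split.
- by move=> v v' /Eeq' h; apply: inj; rewrite !pc; apply: h.
- move=> x; rewrite (nbhd_vertices_words _ _ _ hZ); split => [[w rw ->]|[v <-]].
    have /vert[v vE] : nbhd_vertices aY r y (act_word aY w y).
      by apply/(nbhd_vertices_words _ _ _ hY); exists w.
    by exists v; apply/Eeq' => //; rewrite -pc.
  by exists (c v).
- have : act_word aY (c (proot alpha)) y = act_word aY [::] y by rewrite -pc root.
  by move/Eeq'; apply.
- move=> v i e; have := edge v i e.
  have sz : (size ((i : nat, e) :: c v) <= r.+1)%N by have /andP[] := rc v.
  have al : all (fun a : letter => (a.1 < r)%N) ((i : nat, e) :: c v).
    by rewrite /= ltn_ord; have /andP[] := rc v.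
  case: (pnbr alpha v i e) => [w|].
    by rewrite !pc => h; apply/esym; apply/(Eeq ((i : nat, e) :: c v)).
  move=> h [w [inW E']]; apply: h; exists w; split => //.
  rewrite pc; apply/(Eeq ((i : nat, e) :: c v) w sz al _).2 => //.
  by case/and3P: inW => _ ? ?; apply/andP.
- move=> v j; rewrite labs pc; have /= -> // := E (inr (c v, j : nat)).
  by rewrite mem_ball_tests /= rc ltn_ord.
Qed.

(** Converse direction: the pattern determines every test, because a word of length at most [r] can
    be followed inside it for [y] and [z] simultaneously. *)
Lemma nbhd_iso_passes (r : nat) (alpha : pattern r) (Y Z : Type) actY labY actZ labZ
    (y : Y) (z : Z) : is_action actY -> is_action actZ ->
  Tset actY labY alpha y -> Tset actZ labZ alpha z ->
  ball_equiv r actY labY actZ labZ y z.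
Proof.
move=> hY hZ [phi [inj vert root edge labs]] [psi [inj' vert' root' edge' labs']].
have nav w : in_words r w ->
    exists v, phi v = act_word actY w y /\ psi v = act_word actZ w z.
  elim: w => [|[i e] w IH] rw; first by exists (proot alpha).
  have [ir rw'] := in_words_cons rw; have [v [pE qE]] := IH rw'.
  have := edge v (Ordinal ir) e; have := edge' v (Ordinal ir) e.
  case: (pnbr alpha v (Ordinal ir) e) => [v' h h'|_ []].
    by exists v'; rewrite h h' pE qE.
  by rewrite pE; apply/(nbhd_vertices_words _ _ _ hY); exists ((i, e) :: w).
have eqE u w : in_words r u -> in_words r w ->
    (act_word actY u y = act_word actY w y) <-> (act_word actZ u z = act_word actZ w z).
  move=> /nav[v [<- <-]] /nav[v' [<- <-]].
  by split => [/inj->|/inj'->].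
move=> [] [u w]; rewrite mem_ball_tests /=; last first.
  case/andP=> /nav[v [<- <-]] wr.
  by rewrite -(labs v (Ordinal wr)) -(labs' v (Ordinal wr)).
case/and3P => su au rw.
suff h : (act_word actY u y = act_word actY w y) <-> (act_word actZ u z = act_word actZ w z).
  by apply/asboolP/asboolP => /h.
(* A word of length [r.+1] can leave the ball only by its last move, which is its head letter. If
   the pattern lacks that edge, the tested equality fails at both points. *)
case: u su au => [_ _|[i e] u su /= /andP[ir au]]; first exact: eqE.
have ru : in_words r u by rewrite /in_words au -ltnS su.
have [v [pE qE]] := nav _ ru; have [v' [pE' qE']] := nav _ rw.
have := edge v (Ordinal ir) e; have := edge' v (Ordinal ir) e.
rewrite -pE -qE -pE' -qE' /=.
case: (pnbr alpha v (Ordinal ir) e) => [v'' <- <-|h h'].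
  by split => [/inj->|/inj'->].
split => E; [case: h'|case: h]; rewrite E; [apply/vert|apply/vert']; by exists v'.
Qed.

Lemma nbhd_iso_exists (r : nat) (Y : Type) act lab (y : Y) : is_action act ->
  exists alpha : pattern r, Tset act lab alpha y.
Proof.
move=> hact.
(* Classical decidable equality on an arbitrary type, needed to list the ball without repetition. *)
pose T : eqType := {classic Y}.
pose s : seq T := undup [seq (act_word act w y : T) | w <- words r r].
have us : uniq s by exact: undup_uniq.
have memP (z : T) : z \in s <-> nbhd_vertices act r y z.
  rewrite mem_undup (nbhd_vertices_words _ _ _ hact); split.
    by case/(@mapP word T) => w; rewrite words_ball => rw ->; exists w.
  by case=> w rw ->; apply/(@mapP word T); exists w => //; rewrite words_ball.
have ys : (y : T) \in s by apply/memP/(nbhd_vertices_words _ _ _ hact); exists [::].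
have rs : (index (y : T) s < size s)%N by rewrite index_mem.
pose phi (v : 'I_(size s)) : T := nth (y : T) s v.
have phis v : phi v \in s by exact: mem_nth.
(* The index of a point outside [s] is [size s], so [insub] returns [None] exactly when the edge
   leaves the ball. *)
pose nbr (v : 'I_(size s)) (i : 'I_r) (e : bool) : option 'I_(size s) :=
  insub (index (act i e (phi v) : T) s).
exists (Pattern (Ordinal rs) nbr (fun v j => lab (phi v) j)); exists phi; split => //=.
- move=> v v' vE; apply/val_inj/eqP.
  by rewrite -(nth_uniq (y : T) (ltn_ord v) (ltn_ord v') us); apply/eqP.
- move=> z; rewrite -memP; split => [zs|[v <-]]; last exact: phis.
  have lt : (index (z : T) s < size s)%N by rewrite index_mem.
  by exists (Ordinal lt); rewrite /phi nth_index.
- by rewrite /phi nth_index.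
- move=> v i e; rewrite /nbr; case: insubP => [w|].
    by rewrite index_mem => zs wE; rewrite /phi wE nth_index.
  by rewrite index_mem => zs /memP; apply/negP.
Qed.

(** * Approximating Borel sets by finitely many digits *)

Definition agree (m : nat) (x y : nat -> bool) : Prop := forall i, (i < m)%N -> x i = y i.

Definition finitary (m : nat) (C : set (nat -> bool)) : Prop :=
  forall x y, agree m x y -> C x -> C y.

Lemma agreeC (m : nat) (x y : nat -> bool) : agree m x y -> agree m y x.
Proof. by move=> h i im; rewrite h. Qed.

Lemma agree_leq (m n : nat) (x y : nat -> bool) : (m <= n)%N -> agree n x y -> agree m x y.
Proof. by move=> mn h i im; apply: h; exact: leq_trans mn. Qed.

Lemma measurable_open (U : set cantor_space) : open U -> measurable (U : set Xspace).
Proof. by move=> oU; apply: sub_sigma_algebra. Qed.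

Lemma measurable_digit (n : nat) : measurable [set x : Xspace | x n].
Proof.
apply: (@measurable_open [set x | x n]).
rewrite [X in open X](_ : _ = (proj n : cantor_space -> bool) @^-1` [set true]) //.
by apply: open_comp => [x _|]; [exact: proj_continuous|exact: discrete_open].
Qed.

(** Otherwise points outside [U] agree with [x] on ever longer prefixes and converge to [x] digit by
    digit, contradicting openness. *)
Lemma open_cylinder (U : set cantor_space) (x : cantor_space) : open U -> U x ->
  exists m, forall y, agree m x y -> U y.
Proof.
move=> oU Ux; apply: contrapT => /forallNP h.
have /choice[y hy] : forall m, exists y : cantor_space, agree m x y /\ ~ U y.
  by move=> m; have /existsNP[y /not_implyP] := h m; exists y.
have yx : y n @[n --> \oo] --> (x : cantor_space).
  apply/(@pointwise_cvgP nat bool (y n @[n --> \oo])) => i.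
  apply: cvg_near_cst; exists i.+1 => //= n /= ni.
  by apply/esym; have [+ _] := hy n; apply.
have : \forall n \near \oo, U (y n) by apply: yx; exact: open_nbhs_nbhs.
by case=> n _ /(_ n (leqnn n)); have [] := hy n.
Qed.

(** Induction on [m]: once digit [m] is fixed, the condition concerns the first [m] digits only.
    With no digits the set is empty or full. *)
Lemma measurable_finitary (m : nat) (C : set (nat -> bool)) : finitary m C ->
  measurable (C : set Xspace).
Proof.
elim: m C => [|m IH] C fC.
  have [[x Cx]|nC] := pselect (exists x, C x).
    by rewrite (_ : C = setT) //; apply/seteqP; split => // y _; exact: fC Cx.
  by rewrite (_ : C = set0) //; apply/seteqP; split => // y Cy; apply: nC; exists y.
pose upd (b : bool) (x : nat -> bool) i := if i == m then b else x i.
have mU b : measurable ([set x | C (upd b x)] : set Xspace).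
  apply: IH => x y xy; apply: fC => i; rewrite /upd ltnS leq_eqVlt.
  by case: eqVneq => //= _; exact: xy.
have updE x : upd (x m) x = x by apply/funext => i; rewrite /upd; case: eqVneq => // ->.
rewrite (_ : C = ([set x : Xspace | x m] `&` [set x | C (upd true x)]) `|`
   (~` [set x : Xspace | x m] `&` [set x | C (upd false x)])).
  apply: measurableU; apply: measurableI => //; last apply: measurableC;
    exact: measurable_digit.
apply/seteqP; split => x /=; have := updE x; case: (x m) => ->.
- by left.
- by right.
- by case=> -[].
- by case=> -[].
Qed.

Section SmallSets.
Context {R : realType} (mu : probability Xspace R).

(* Covering by a measurable set lets [small] apply to sets not known to be measurable. *)
Definition small (eps : R) (A : set Xspace) : Prop :=
  exists B, [/\ measurable B, A `<=` B & (mu B <= eps%:E)%E].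

Lemma small_sub (e d : R) (A B : set Xspace) : A `<=` B -> e <= d -> small e B -> small d A.
Proof.
move=> AB ed [C [mC BC muC]]; exists C; split => //; first exact: subset_trans BC.
by apply: le_trans muC _; rewrite lee_fin.
Qed.

Lemma smallU (e d : R) (A B : set Xspace) : small e A -> small d B -> small (e + d) (A `|` B).
Proof.
move=> [C [mC AC muC]] [D [mD BD muD]]; exists (C `|` D); split.
- exact: measurableU.
- exact: setUSS.
- by apply: le_trans (measureU2 _ mC mD) _; rewrite EFinD leeD.
Qed.

Lemma small0 : small 0 set0.
Proof. by exists set0; split; [exact: measurable0| |rewrite measure0]. Qed.

(** The tails decrease to the empty set, so continuity from above of a finite measure applies. *)
Lemma small_bigcup_tail (F : nat -> set Xspace) (eps : R) : 0 < eps ->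
  (forall n, measurable (F n)) ->
  exists n, small eps (\bigcup_k F k `\` \bigcup_(k < n) F k).
Proof.
move=> e0 mF.
pose G n := \bigcup_k F k `\` \bigcup_(k < n) F k.
have mG n : measurable (G n).
  by apply: measurableD; [exact: bigcupT_measurable|exact: bigcup_measurable].
have G0 : \bigcap_n G n = set0.
  apply/seteqP; split => // x Gx; have [[k _ Fk] _] := Gx 0%N I.
  by have [_] := Gx k.+1 I; apply; exists k => //=.
have : mu (G n) @[n --> \oo] --> mu (\bigcap_n G n).
  apply: nonincreasing_cvg_mu => //.
  - by rewrite (le_lt_trans (probability_le1 _ _)) // ltry.
  - by rewrite G0.
  - move=> n m nm; apply/subsetPset => x [Fx nx]; split => // -[k /= kn Fk].
    by apply: nx; exists k => //=; exact: leq_trans nm.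
rewrite G0 measure0 => /fine_cvg/cvgrPdist_le/(_ _ e0)[n _ /(_ n (leqnn n))] /= h.
exists n; exists (G n); split => //.
have fG : mu (G n) \is a fin_num by exact: fin_num_measure.
rewrite -(fineK fG) lee_fin; move: h; rewrite sub0r normrN.
exact: le_trans (ler_norm _).
Qed.

(** Measurability is carried along because the countable-union step uses continuity of the
    measure. *)
Definition approximable (A : set Xspace) : Prop :=
  measurable A /\ forall eps : R, 0 < eps ->
    exists m C, finitary m C /\ small eps [set x | ~ (A x <-> C x)].

Lemma approximableU (A B : set Xspace) : approximable A -> approximable B ->
  approximable (A `|` B).
Proof.
move=> [mA hA] [mB hB]; split; first exact: measurableU.
move=> eps e0; have e2 : 0 < eps / 2 by rewrite divr_gt0.
have [m [C [fC sC]]] := hA _ e2; have [n [D [fD sD]]] := hB _ e2.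
exists (maxn m n), (C `|` D); split.
  move=> x y xy [Cx|Dx]; [left; apply: fC Cx|right; apply: fD Dx].
    exact: agree_leq (leq_maxl _ _) xy.
  exact: agree_leq (leq_maxr _ _) xy.
rewrite [eps]splitr; apply: small_sub (smallU sC sD) => // x /= nE.
by have [E|] := pselect (A x <-> C x); [right|left] => // E'; apply: nE; rewrite /setU /=; tauto.
Qed.

Lemma approximable_finitary (m : nat) (C : set (nat -> bool)) : finitary m C ->
  approximable C.
Proof.
move=> fC; split; first exact: measurable_finitary fC.
move=> eps e0; exists m, C; split => //; apply: small_sub small0; last exact: ltW.
by move=> x /=; apply.
Qed.

(** Half of the error truncates the union, the other half approximates the finite union that
    remains. *)
Lemma approximable_bigcup (F : nat -> set Xspace) : (forall n, approximable (F n)) ->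
  approximable (\bigcup_n F n).
Proof.
move=> aF; have mF n : measurable (F n) by have [] := aF n.
split; first exact: bigcupT_measurable.
move=> eps e0; have e2 : 0 < eps / 2 by rewrite divr_gt0.
have [n sn] := small_bigcup_tail e2 mF.
have [_ /(_ _ e2)[m [C [fC sC]]]] : approximable (\bigcup_(k < n) F k).
  elim: n {sn} => [|n IH].
    rewrite bigcup_mkord big_ord0.
    by apply: (@approximable_finitary 0 set0).
  by rewrite bigcup_mkord big_ord_recr /= -bigcup_mkord; exact: approximableU.
exists m, C; split => //.
rewrite [eps]splitr; apply: small_sub (smallU sn sC) => // x /= nE.
have [E|] := pselect ((\bigcup_(k < n) F k) x <-> C x); [left|right] => //.
have sub : (\bigcup_(k < n) F k) x -> (\bigcup_k F k) x.
  by case=> k _ ?; exists k.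
by rewrite /setD /=; split; [apply: contrapT|]; tauto.
Qed.

(** The approximable sets form a sigma-algebra, so it suffices to treat open sets. *)
Lemma measurable_approximable (A : set Xspace) : measurable A -> approximable A.
Proof.
apply: smallest_sub A; last first.
  move=> U oU.
  (* [V n] consists of the points whose cylinder of length [n] lies in [U]; it is finitary, and
     these sets exhaust [U]. *)
  pose V n : set (nat -> bool) := [set x | forall y, agree n x y -> U y].
  rewrite (_ : U = \bigcup_n V n).
    apply: approximable_bigcup => n; apply: (@approximable_finitary n) => x y xy Vx z yz.
    by apply: Vx => i im; rewrite xy // yz.
  apply/seteqP; split => [x /(open_cylinder oU)[n h]|x [n _]]; first by exists n.
  by apply.
split.
- exact: (@approximable_finitary 0 set0).
- move=> A [mA hA]; rewrite setTD; split; first exact: measurableC.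
  move=> eps /hA[m [C [fC sC]]]; exists m, (~` C); split.
    by move=> x y /agreeC xy nC /(fC _ _ xy).
  by apply: small_sub sC => // x /=; tauto.
- exact: approximable_bigcup.
Qed.

End SmallSets.

(** * Convergence of local statistics *)

Lemma measurable_act_word (R : realType) (mu : probability Xspace R)
    (act : nat -> bool -> Xspace -> Xspace) (w : word) :
  mp_borel_action mu act -> measurable_fun setT (act_word act w).
Proof.
move=> [_ mp]; elim: w => [|a w IH]; first exact: measurable_id.
by apply: (measurableT_comp _ IH); have [] := mp a.1 a.2.
Qed.

(** Equality in [Xspace] is agreement of all digits, a countable intersection of Borel
    conditions. *)
Lemma measurable_eqfun (f g : Xspace -> Xspace) :
  measurable_fun setT f -> measurable_fun setT g -> measurable [set x | f x = g x].
Proof.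
move=> mf mg.
have mdig h n : measurable_fun setT h -> measurable [set x : Xspace | (h x : Xspace) n].
  by move=> mh; rewrite -[X in measurable X]setTI; exact: (mh measurableT _ (measurable_digit n)).
rewrite (_ : mkset _ = \bigcap_n (([set x | f x n] `&` [set x | g x n]) `|`
     (~` [set x | f x n] `&` ~` [set x | g x n]))).
  apply: bigcapT_measurable => n.
  have mfn := mdig f n mf; have mgn := mdig g n mg.
  by apply: measurableU; apply: measurableI => //; apply: measurableC.
apply/seteqP; split => [x /= E n _ /=|x /= E].
  by rewrite E; have [] := pselect (g x n : Prop); [left|right].
apply/funext => n; have /= := E n I.
by case: (f x n) (g x n) => [] [] // [[]|[]].
Qed.

Lemma measurable_passes (R : realType) (mu : probability Xspace R)
    (act : nat -> bool -> Xspace -> Xspace) (k : test) : mp_borel_action mu act ->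
  measurable [set x : Xspace | passes act id x k].
Proof.
move=> mp; case: k => -[u w] /=.
  rewrite (_ : mkset _ = [set x | act_word act u x = act_word act w x]).
    by apply: measurable_eqfun; exact: (measurable_act_word _ mp).
  by apply/seteqP; split => x /asboolP.
rewrite -[X in measurable X]setTI.
exact: (measurable_act_word u mp) (measurable_digit w).
Qed.

Definition profile (Y : Type) (act : nat -> bool -> Y -> Y) (lab : Y -> nat -> bool)
  (K : seq test) (y : Y) : seq bool := [seq passes act lab y k | k <- K].

Lemma measurable_profile (R : realType) (mu : probability Xspace R)
    (act : nat -> bool -> Xspace -> Xspace) (K : seq test) (P : seq bool -> Prop) :
  mp_borel_action mu act -> measurable [set x : Xspace | P (profile act id K x)].
Proof.
move=> mp; elim: K P => [|k K IH] P /=.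
  have [p|np] := pselect (P [::]).
    by rewrite (_ : mkset _ = setT) //; apply/seteqP; split.
  by rewrite (_ : mkset _ = set0) //; apply/seteqP; split.
rewrite (_ : mkset _ =
  ([set x | passes act id x k] `&` [set x | P (true :: profile act id K x)]) `|`
  (~` [set x | passes act id x k] `&` [set x | P (false :: profile act id K x)])).
  have mk := measurable_passes k mp.
  have mP b := IH (fun t => P (b :: t)).
  by apply: measurableU; apply: measurableI; [exact: mk|exact: mP|exact: measurableC|exact: mP].
apply/seteqP; split => x /=; rewrite /profile /=; case: (passes _ _ _ _).
- by left.
- by right.
- by case=> -[].
- by case=> -[].
Qed.

Lemma profile_eq (Y Z : Type) actY labY actZ labZ (K : seq test) (y : Y) (z : Z) :
  profile actY labY K y = profile actZ labZ K z <->
  {in K, passes actY labY y =1 passes actZ labZ z}.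
Proof. by split=> [/eq_in_map|h]; [|apply/eq_in_map]. Qed.

(** Turns a statistic into a predicate on bit vectors. For a local [Q] the choice of the witnessing
    action is immaterial. *)
Definition realized (r : nat) (Q : local_statistic) (t : seq bool) : Prop :=
  exists (Y : Type) act lab (y : Y),
    [/\ is_action act, t = profile act lab (ball_tests r) y & Q Y act lab y].

Lemma is_localE (r : nat) (Q : local_statistic) (Y : Type) act lab (y : Y) :
  is_local r Q -> is_action act ->
  Q Y act lab y <-> realized r Q (profile act lab (ball_tests r) y).
Proof.
move=> lQ hact; split=> [Qy|[Z [aZ [lZ [z [hZ /esym/profile_eq E]]]]]].
  by exists Y, act, lab, y.
exact: lQ hZ hact E.
Qed.

Lemma measurable_local (R : realType) (mu : probability Xspace R)
    (act : nat -> bool -> Xspace -> Xspace) (r : nat) (Q : local_statistic) :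
  mp_borel_action mu act -> is_local r Q -> measurable [set x : Xspace | Q _ act id x].
Proof.
move=> mp lQ.
rewrite (_ : mkset _ = [set x : Xspace | realized r Q (profile act id (ball_tests r) x)]).
  exact: (measurable_profile _ (realized r Q) mp).
by apply/seteqP; split=> x /= ?; apply/(is_localE _ _ lQ mp.1).
Qed.

Definition freq (R : realType) (Y : finType) (A : set Y) : R :=
  #|[pred y : Y | `[< A y >]]|%:R / #|Y|%:R.

Lemma p_finE (R : realType) (Y : finType) act lab (r : nat) (alpha : pattern r) :
  p_fin R act lab alpha = freq R (@Tset Y act lab r alpha).
Proof.
rewrite /p_fin /freq; congr (_%:R / _); by apply: eq_card => y; rewrite [RHS]inE; exact: asboolb.
Qed.

Lemma freq_setU (R : realType) (Y : finType) (A B : set Y) : A `&` B = set0 ->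
  freq R (A `|` B) = freq R A + freq R B.
Proof.
move=> AB; rewrite /freq -mulrDl -natrD -cardUI; congr (_%:R / _); rewrite -[LHS]addn0.
congr addn; last first.
  apply/esym/eq_card0 => y; rewrite !inE; apply/negP => /andP[/asboolP Ay /asboolP By].
  by have : (A `&` B) y by []; rewrite AB.
by apply: eq_card => y; rewrite !inE -asbool_or.
Qed.

Lemma freq_eq (R : realType) (Y : finType) (A B : set Y) : (forall y, A y <-> B y) ->
  freq R A = freq R B.
Proof. by move=> AB; rewrite (_ : A = B) //; apply/seteqP; split=> y /AB. Qed.

Lemma freq_set0 (R : realType) (Y : finType) : freq R (@set0 Y) = 0.
Proof.
by rewrite /freq eq_card0 ?mul0r // => y; rewrite inE; apply/asboolP.
Qed.

Lemma perm_act_action (Y : finType) (s : nat -> {perm Y}) : is_action (perm_act s).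
Proof. by move=> i; split=> y; rewrite /perm_act ?permK ?permKV. Qed.

(** A realized profile of the ball tests describes the same event as some pattern, so its frequency
    converges by hypothesis; a local statistic is a finite disjoint union of such events. *)
Lemma sofic_local_cvg (R : realType) (mu : probability Xspace R)
    (act : nat -> bool -> Xspace -> Xspace) (Y : nat -> finType)
    (lab : forall n, Y n -> nat -> bool) (s : forall n, nat -> {perm Y n})
    (r : nat) (Q : local_statistic) :
  mp_borel_action mu act ->
  (forall alpha : pattern r,
    ((fun n => (p_fin R (perm_act (s n)) (lab n) alpha)%:E) @ \oo
        --> mu (Tset act id alpha))%E) ->
  is_local r Q ->
  (fun n => freq R (Q (Y n) (perm_act (s n)) (lab n))) @ \oo
    --> (fine (mu [set x : Xspace | Q _ act id x]) : R).
Proof.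
move=> mp cv lQ; have hact := mp.1.
pose B := ball_tests r.
have cv1 (t : seq bool) :
    (fun n => freq R [set y | profile (perm_act (s n)) (lab n) B y = t]) @ \oo
      --> (fine (mu [set x | profile act id B x = t]) : R).
  have [[Z [aZ [lZ [z [hZ tE]]]]]|nt] := pselect (realized r (fun _ _ _ _ => True) t).
    have [alpha za] := @nbhd_iso_exists r Z aZ lZ z hZ.
    have E (W : Type) aW lW (w : W) : is_action aW ->
        profile aW lW B w = t <-> Tset aW lW alpha w.
      move=> hW; split=> [|wa].
        by rewrite tE => /esym/profile_eq E; case: (nbhd_iso_local hZ hW E za) => phi h; exists phi.
      by rewrite tE; apply/profile_eq; exact: nbhd_iso_passes hW hZ wa za.
    rewrite (_ : mkset _ = Tset act id alpha); last first.
      by apply/seteqP; split=> x /= ?; apply/E.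
    rewrite (_ : (fun n => _) = (fun n => p_fin R (perm_act (s n)) (lab n) alpha)); last first.
      by apply/funext => n; rewrite p_finE; apply: freq_eq => y; apply: E; exact: perm_act_action.
    have fm := fin_num_measure mu _ (measurable_local mp (@nbhd_iso_local r alpha)).
    have := cv alpha; rewrite -(fineK fm) => /fine_cvg; exact.
  (* A vector realized by no action occurs neither on [Xspace] nor on the models, so both sides
     vanish. *)
  rewrite (_ : mkset _ = set0) ?measure0; last first.
    by apply/seteqP; split=> // x /= xt; apply: nt; exists _, act, id, x.
  rewrite (_ : (fun n => _) = cst 0); first exact: cvg_cst.
  apply/funext => n; rewrite (@freq_eq _ _ _ set0) ?freq_set0 // => y; split=> // yt.
  by apply: nt; exists _, (perm_act (s n)), (lab n), y; split=> //; exact: perm_act_action.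
have cv2 (ts : seq (seq bool)) : uniq ts ->
    (fun n => freq R [set y | profile (perm_act (s n)) (lab n) B y \in ts]) @ \oo
      --> (fine (mu [set x | profile act id B x \in ts]) : R).
  elim: ts => [_|t ts IH /= /andP[tts /IH cvts]].
    rewrite (_ : mkset _ = set0) ?measure0; last by apply/seteqP; split.
    rewrite (_ : (fun n => _) = cst 0); first exact: cvg_cst.
    by apply/funext => n; rewrite (@freq_eq _ _ _ set0) ?freq_set0.
  rewrite (_ : [set x | _ \in t :: ts] =
    [set x | profile act id B x = t] `|` [set x | profile act id B x \in ts]); last first.
    by apply/seteqP; split=> x /=; rewrite in_cons;
      [case/predU1P; [left|right]|case=> [->|->]; rewrite ?eqxx ?orbT].
  have mt := measurable_profile B (fun u => u = t) mp.
  have mts := measurable_profile B (fun u => u \in ts) mp.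
  have dis (W : Type) aW lW :
      [set w : W | profile aW lW B w = t] `&` [set w | profile aW lW B w \in ts] = set0.
    by apply/seteqP; split=> // x /= [-> h]; rewrite h in tts.
  rewrite (measureU mu mt mts) ?dis // fineD; [|exact: (fin_num_measure mu)..].
  rewrite (_ : (fun n => freq R [set y | _ \in t :: ts]) =
     (fun n => freq R [set y | profile (perm_act (s n)) (lab n) B y = t] +
       freq R [set y | profile (perm_act (s n)) (lab n) B y \in ts])); last first.
    apply/funext => n; rewrite -freq_setU ?dis //.
    apply: freq_eq => y /=; rewrite in_cons.
    by split; [case/predU1P; [left|right]|case=> [->|->]; rewrite ?eqxx ?orbT].
  exact: cvgD.
(* There are finitely many bit vectors of the length of [B]; [ts] lists those on which [Q] holds. *)
pose ts := [seq val t | t <- enum {: (size B).-tuple bool} & `[< realized r Q (val t) >]].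
have tsE (W : Type) aW lW (w : W) : is_action aW ->
    Q W aW lW w <-> profile aW lW B w \in ts.
  move=> hW; rewrite (is_localE _ _ lQ hW); split=> [q|/mapP[t]]; last first.
    by rewrite mem_filter => /andP[/asboolP + _] => /[swap] <-.
  apply/mapP; exists (map_tuple (passes aW lW w) (in_tuple B)) => //.
  by rewrite mem_filter mem_enum andbT; apply/asboolP.
rewrite (_ : [set x | _] = [set x | profile act id B x \in ts]); last first.
  by apply/seteqP; split=> x /= ?; apply/tsE.
rewrite (_ : (fun n => _) =
    (fun n => freq R [set y | profile (perm_act (s n)) (lab n) B y \in ts])).
  by apply: cv2; rewrite (map_inj_uniq val_inj) filter_uniq ?enum_uniq.
by apply/funext => n; apply: freq_eq => y; apply: tsE; exact: perm_act_action.
Qed.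

(** * Replacing the second action by a finitary rule for the first *)

Definition finitary_rule (D : (nat -> bool) -> word) : Prop :=
  exists m (V : seq word), (forall x y, agree m x y -> D x = D y) /\ forall x, D x \in V.

(** There are countably many words, so the sets [A k] where the word [w k] has the effect of [T]
    cover almost every point. Finitely many of them suffice up to a small error, and each is then
    replaced by a finitary set. *)
Lemma finitary_rule_exists (R : realType) (mu : probability Xspace R)
    (act : nat -> bool -> Xspace -> Xspace) (T : Xspace -> Xspace) (eps : R) :
  mp_borel_action mu act -> measurable_fun setT T ->
  {ae mu, forall x, F_orbit act x (T x)} -> 0 < eps ->
  exists D, finitary_rule D /\ small mu eps [set x | act_word act (D x) x <> T x].
Proof.
move=> mp mT ae e0; have e2 : 0 < eps / 2 by rewrite divr_gt0.
pose w k : word := odflt [::] (unpickle k).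
pose A k := [set x | act_word act (w k) x = T x].
have mA k : measurable (A k).
  by apply: measurable_eqfun => //; exact: (measurable_act_word _ mp).
have [n sn] := small_bigcup_tail mu e2 mA.
(* Induction on the number of words: on a finitary approximation [C] of [A n] the new word overrides
   the earlier rule. Each override spends half of the error allowed, hence the generalisation over
   [eps / 2]. *)
have [D [fD sD]] : exists D, finitary_rule D /\
    small mu (eps / 2) [set x | (exists2 k, (k < n)%N & A k x) /\ act_word act (D x) x <> T x].
  elim: n (eps / 2) e2 {sn} => [|n IH] d d0.
    exists (fun=> [::]); split; first by exists 0%N, [:: [::]].
    by apply: small_sub (small0 mu); [move=> x [[]]|exact: ltW].
  have d2 : 0 < d / 2 by rewrite divr_gt0.
  have [D [[m [V [agD DV]]] sD]] := IH _ d2.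
  have [_ /(_ _ d2)[m' [C [fC sC]]]] := measurable_approximable mu (mA n).
  exists (fun x => if `[< C x >] then w n else D x); split.
    exists (maxn m m'), (w n :: V); split => [x y xy|x]; last first.
      by case: asboolP => _; rewrite in_cons ?eqxx // DV orbT.
    have xy' := agree_leq (leq_maxr _ _) xy.
    rewrite (agD _ _ (agree_leq (leq_maxl _ _) xy)).
    by congr (if _ then _ else _); apply/asboolP/asboolP; apply: fC => //; exact: agreeC.
  rewrite [d]splitr; apply: small_sub (smallU sD sC) => // x [[k kn Ak]] /=.
  case: asboolP => Cx nT; first by right => -[_ /(_ Cx)].
  move: kn Ak; rewrite ltnS leq_eqVlt => /predU1P[-> Ak|kn Ak]; first by right => -[/(_ Ak)].
  by left; split => //; exists k.
exists D; split => //; rewrite [eps]splitr.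
have [Z [mZ Z0 sZ]] := ae.
have sZ' : small mu 0 (~` [set x | F_orbit act x (T x)]) by exists Z; rewrite Z0.
rewrite -[X in small mu X]addr0; apply: small_sub (smallU (smallU sn sD) sZ') => // x nE.
have [[u uE]|nO] := pselect (F_orbit act x (T x)); last by right.
left; have [[k kn Ak]|nk] := pselect (exists2 k, (k < n)%N & A k x).
  by right; split=> //; exists k.
left; split; last by case=> k kn Ak; apply: nk; exists k.
have wu : w (pickle u) = u by rewrite /w pickleK.
by exists (pickle u) => //; rewrite /A /mkset wu.
Qed.

(** In general not an action: the rules for a letter and for its inverse need not cancel. *)
Definition rule_act (D : nat -> bool -> (nat -> bool) -> word) (Y : Type)
    (act : nat -> bool -> Y -> Y) (lab : Y -> nat -> bool) : nat -> bool -> Y -> Y :=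
  fun i e y => act_word act (D i e (lab y)) y.

Lemma in_words_leq (r r' : nat) (w : word) : (r <= r')%N -> in_words r w -> in_words r' w.
Proof.
move=> rr /andP[sz al]; rewrite /in_words (leq_trans sz rr).
by apply: sub_all al => a /leq_trans; exact.
Qed.

Lemma in_words_cat (r r' : nat) (u w : word) : in_words r u -> in_words r' w ->
  in_words (r + r') (u ++ w).
Proof.
move=> /andP[su au] /andP[sw aw]; rewrite /in_words size_cat leq_add //= all_cat.
apply/andP; split; [apply: sub_all au|apply: sub_all aw] => a /leq_trans; apply.
  exact: leq_addr.
exact: leq_addl.
Qed.

Lemma in_words_bound (V : seq word) : exists r, forall v, v \in V -> in_words r v.
Proof.
elim: V => [|v V [r IH]]; first by exists 0%N.
have [q vq] : exists q, in_words q v.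
  elim: v => [|a v [q vq]]; first by exists 0%N.
  exists (a.1.+1 + q)%N; apply: (@in_words_cat _ _ [:: a]) => //.
  by rewrite /in_words /= ltnSn.
exists (q + r)%N => u; rewrite in_cons => /predU1P[->|/IH].
  by apply: in_words_leq vq; exact: leq_addr.
by apply: in_words_leq; exact: leq_addl.
Qed.

Section RuleLocality.
Variable D : nat -> bool -> (nat -> bool) -> word.
Hypothesis finD : forall i e, finitary_rule (D i e).

(** Running rules along [w] amounts to applying one word [u] in the original letters, selected by
    the digits met on the way. Equivalent balls show the same digits, hence select the same [u]. *)
Lemma rule_word_local (w : word) : exists r,
  forall (Y Z : Type) actY labY actZ labZ (y : Y) (z : Z),
  ball_equiv r actY labY actZ labZ y z ->
  exists u, [/\ in_words r u,
                act_word (rule_act D actY labY) w y = act_word actY u y &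
                act_word (rule_act D actZ labZ) w z = act_word actZ u z].
Proof.
elim: w => [|[i e] w [r IH]]; first by exists 0%N => *; exists [::].
have [m [V [agD DV]]] := finD i e; have [q Vq] := in_words_bound V.
(* [q] bounds the words the new rule can output, [r] is the radius for the tail, and [m] is the
   number of digits the rule reads. *)
exists (q + (r + m))%N => Y Z aY lY aZ lZ y z E.
have rE : (r <= q + (r + m))%N by rewrite addnCA leq_addr.
have [u [ru yE zE]] := IH _ _ _ _ _ _ _ _ (ball_equiv_leq rE E).
exists (D i e (lY (act_word aY u y)) ++ u); split.
- by rewrite addnA; apply: in_words_leq (in_words_cat (Vq _ (DV _)) ru); exact: leq_addr.
- by rewrite act_word_cons yE /= /rule_act act_word_cat.
- rewrite act_word_cons zE /= /rule_act act_word_cat; congr (act_word _ _ _).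
  apply: agD => j jm; have /= -> // := E (inr (u, j)).
  rewrite mem_ball_tests /= (in_words_leq rE ru) /=.
  by rewrite (leq_trans jm) // addnA leq_addl.
Qed.

Lemma rule_passes_local (k : test) :
  exists r, forall (Y Z : Type) actY labY actZ labZ (y : Y) (z : Z),
  ball_equiv r actY labY actZ labZ y z ->
  passes (rule_act D actY labY) labY y k = passes (rule_act D actZ labZ) labZ z k.
Proof.
case: k => -[u w].
  have [r1 h1] := rule_word_local u; have [r2 h2] := rule_word_local w.
  exists (r1 + r2)%N => Y Z aY lY aZ lZ y z E /=.
  have [u' [ru -> ->]] := h1 _ _ _ _ _ _ _ _ (ball_equiv_leq (leq_addr _ _) E).
  have [w' [rw -> ->]] := h2 _ _ _ _ _ _ _ _ (ball_equiv_leq (leq_addl _ _) E).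
  have := E (inl (u', w')); apply; rewrite mem_ball_tests /=.
  rewrite (in_words_leq (leq_addl _ _) rw) andbT.
  by have /andP[su ->] := in_words_leq (leq_addr r2 _) ru; rewrite leqW.
have [r h] := rule_word_local u.
(* Here [w] is a digit index, which must lie strictly below the radius. *)
exists (r + w.+1)%N => Y Z aY lY aZ lZ y z E /=.
have [u' [ru -> ->]] := h _ _ _ _ _ _ _ _ (ball_equiv_leq (leq_addr _ _) E).
have := E (inr (u', w)); apply; rewrite mem_ball_tests /=.
by rewrite (in_words_leq (leq_addr _ _) ru) leq_addl.
Qed.

(** The radius depends on [K] alone and serves all [P]. It is made positive because soficity speaks
    of [r >= 1] only. *)
Lemma rule_profile_local (K : seq test) : exists2 r, (0 < r)%N &
  forall P : seq bool -> Prop,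
    is_local r (fun Y act lab y => P (profile (rule_act D act lab) lab K y)).
Proof.
have [r h] : exists r, forall (Y Z : Type) actY labY actZ labZ (y : Y) (z : Z),
    ball_equiv r actY labY actZ labZ y z ->
    profile (rule_act D actY labY) labY K y = profile (rule_act D actZ labZ) labZ K z.
  elim: K => [|k K [r IH]]; first by exists 0%N.
  have [q h] := rule_passes_local k.
  exists (q + r)%N => Y Z aY lY aZ lZ y z E; rewrite /profile /=; congr cons.
    exact: h (ball_equiv_leq (leq_addr _ _) E).
  exact: IH (ball_equiv_leq (leq_addl _ _) E).
exists r.+1 => // P Y Z aY lY aZ lZ y z _ _ E.
by rewrite (h _ _ _ _ _ _ _ _ (ball_equiv_leq (leqnSn r) E)).
Qed.

End RuleLocality.

(** * Stability under perturbation of the generators *)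

(* What [small mu] for a measure-preserving action and [freq _ <= _] for a finite
   permutation action have in common. *)
Definition smallness (R : realType) (Y : Type) (N : nat) (act : nat -> bool -> Y -> Y)
    (S : R -> set Y -> Prop) : Prop :=
  [/\ S 0 set0,
      forall e d A B, A `<=` B -> e <= d -> S e B -> S d A,
      forall e d A B, S e A -> S d B -> S (e + d) (A `|` B) &
      forall i b e A, (i < N)%N -> S e A -> S e (act i b @^-1` A)].

(** The number of moves made in evaluating a test: each is an occasion for two nearby families of
    generators to part. *)
Definition cost (k : test) : nat :=
  match k with inl p => size p.1 + size p.2 | inr p => size p.1 end.

Section Perturbation.
Context {R : realType} {Y : Type} {N : nat} {act act' : nat -> bool -> Y -> Y}
  {S : R -> set Y -> Prop} (lab : Y -> nat -> bool) (eta : R).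
Hypotheses (smS : smallness N act S)
  (close : forall i b, (i < N)%N -> S eta [set y | act' i b y <> act i b y]).

Lemma small_act_word_preimage (w : word) (e : R) (A : set Y) :
  all (fun a : letter => (a.1 < N)%N) w -> S e A -> S e (act_word act w @^-1` A).
Proof.
have [_ _ _ inv] := smS.
elim: w A => [|a w IH] A //= /andP[aN wN] sA.
exact: (IH (act a.1 a.2 @^-1` A) wN (inv _ _ _ _ aN sA)).
Qed.

(** Two evaluations that differ either differ already on the tail or part at the head letter. The
    latter bad set is pulled back along [act], whose letters preserve smallness. *)
Lemma perturb_word (w : word) : all (fun a : letter => (a.1 < N)%N) w ->
  S ((size w)%:R * eta) [set y | act_word act' w y <> act_word act w y].
Proof.
have [S0 Smono SU _] := smS.
elim: w => [_|a w IH /= /andP[aN wN]].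
  by apply: Smono S0 => //=; rewrite mul0r.
have s2 := small_act_word_preimage wN (close a.2 aN).
apply: Smono (SU _ _ _ _ (IH wN) s2); last by rewrite -natr1 mulrDl mul1r.
move=> y /=; have [->|ne _] := pselect (act_word act' w y = act_word act w y).
  by right.
by left.
Qed.

Lemma perturb_profile (K : seq test) : {subset K <= ball_tests N} ->
  S ((\sum_(k <- K) cost k)%:R * eta)
    [set y | profile act' lab K y <> profile act lab K y].
Proof.
have [S0 Smono SU _] := smS.
have one k : k \in ball_tests N ->
    S ((cost k)%:R * eta) [set y | passes act' lab y k <> passes act lab y k].
  rewrite mem_ball_tests; case: k => -[u w] /=.
    case/and3P=> _ au /andP[_ aw].
    apply: Smono (SU _ _ _ _ (perturb_word au) (perturb_word aw)); last first.
      by rewrite natrD mulrDl.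
    move=> y /= ne; have [Eu|] := pselect (act_word act' u y = act_word act u y); last by left.
    by right => Ew; apply: ne; rewrite Eu Ew.
  case/andP=> /andP[_ au] _; apply: Smono (perturb_word au) => // y /= ne E.
  by apply: ne; rewrite E.
elim: K => [_|k K IH KN]; first by apply: Smono S0; rewrite ?big_nil ?mul0r.
have kN : k \in ball_tests N by apply: KN; rewrite mem_head.
have sK : {subset K <= ball_tests N} by move=> j jK; apply: KN; rewrite in_cons jK orbT.
apply: Smono (SU _ _ _ _ (one k kN) (IH sK)); last by rewrite big_cons natrD mulrDl.
move=> y /= ne.
have [Ek|] := pselect (passes act' lab y k = passes act lab y k); last by left.
by right => EK; apply: ne; rewrite Ek EK.
Qed.

End Perturbation.

Lemma small_smallness (R : realType) (mu : probability Xspace R) (N : nat)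
    (act : nat -> bool -> Xspace -> Xspace) :
  mp_borel_action mu act -> smallness N act (small mu).
Proof.
move=> [_ mp]; split.
- exact: small0.
- by move=> e d A B; exact: small_sub.
- by move=> e d A B; exact: smallU.
- move=> i b e A _ [B [mB AB muB]]; have [mact muact] := mp i b.
  exists (act i b @^-1` B); split; [|exact: preimage_subset|by rewrite muact].
  by rewrite -[X in measurable X]setTI; exact: (mact measurableT _ mB).
Qed.

Lemma small_dist (R : realType) (mu : probability Xspace R) (e : R) (A B : set Xspace) :
  measurable A -> measurable B -> small mu e [set x | ~ (A x <-> B x)] ->
  `|fine (mu A) - fine (mu B)| <= e.
Proof.
move=> mA mB [C [mC sub muC]].
have half (A' B' : set Xspace) : measurable A' -> measurable B' ->
    A' `<=` B' `|` C -> fine (mu A') - fine (mu B') <= e.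
  move=> mA' mB' sub'; rewrite lerBlDl -lee_fin EFinD !fineK; try exact: (fin_num_measure mu).
  apply: le_trans (leeD2l _ muC); apply: le_trans (measureU2 mu mB' mC).
  by apply: le_measure => //; apply: mem_set => //; exact: measurableU.
rewrite ler_norml lerNl opprB; apply/andP; split; apply: half => // x.
  by move=> Bx; have [|nA] := pselect (A x); [left|right; apply: sub => /= -[_ /(_ Bx)]].
by move=> Ax; have [|nB] := pselect (B x); [left|right; apply: sub => /= -[/(_ Ax)]].
Qed.

Lemma freq_le (R : realType) (Y : finType) (A B : set Y) : A `<=` B ->
  freq R A <= freq R B.
Proof.
move=> AB; rewrite /freq ler_wpM2r ?invr_ge0 ?ler0n // ler_nat.
by apply/subset_leq_card/fintype.subsetP => y; rewrite !inE => /asboolP/AB/asboolP.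
Qed.

Lemma freqU_le (R : realType) (Y : finType) (A B : set Y) :
  freq R (A `|` B) <= freq R A + freq R B.
Proof.
have -> : A `|` B = A `|` (B `\` A).
  by apply/seteqP; split=> y; have [] := pselect (A y); rewrite /setU /setD /=; tauto.
rewrite freq_setU ?lerD2l; last by apply/seteqP; split=> y // [Ay []].
by apply: freq_le => y [].
Qed.

Lemma freq_smallness (R : realType) (N : nat) (Y : finType) (s : nat -> {perm Y}) :
  smallness N (perm_act s) (fun (e : R) A => freq R A <= e).
Proof.
split.
- by rewrite freq_set0.
- by move=> e d A B /(freq_le R) AB ed /(le_trans AB) /le_trans; exact.
- by move=> e d A B hA hB; apply: le_trans (freqU_le _ _ _) _; exact: lerD.
- move=> i b e A _; apply: le_trans; rewrite /freq ler_wpM2r ?invr_ge0 ?ler0n // ler_nat.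
  have inj : injective (perm_act s i b) by case: b => y z /perm_inj.
  rewrite -(card_imset _ inj); apply/subset_leq_card/fintype.subsetP => z /imsetP[y].
  by rewrite !inE => /asboolP ? ->; apply/asboolP.
Qed.

Lemma freq_dist (R : realType) (Y : finType) (e : R) (A B : set Y) :
  freq R [set y | ~ (A y <-> B y)] <= e -> `|freq R A - freq R B| <= e.
Proof.
move=> h.
have half (A' B' : set Y) : A' `<=` B' `|` [set y | ~ (A y <-> B y)] ->
    freq R A' - freq R B' <= e.
  move=> sub; rewrite lerBlDl; apply: le_trans (freq_le R sub) _.
  by apply: le_trans (freqU_le _ _ _) _; rewrite lerD2l.
rewrite ler_norml lerNl opprB; apply/andP; split; apply: half => y.
  by move=> By; have [|nA] := pselect (A y); [left|right => /= -[_ /(_ By)]].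
by move=> Ay; have [|nB] := pselect (B y); [left|right => /= -[/(_ Ay)]].
Qed.

(** The complements of [A] and of its image have equal size, so their enumerations can be matched
    term by term. *)
Lemma perm_extension (Y : finType) (A : {set Y}) (f : Y -> Y) : {in A &, injective f} ->
  exists s : {perm Y}, {in A, s =1 f}.
Proof.
move=> injf.
pose cA := enum (~: A)%SET; pose cB := enum (~: (f @: A))%SET.
have sz : size cA = size cB.
  by rewrite -!cardE; apply/eqP; rewrite -(eqn_add2l #|A|) cardsC -(card_in_imset injf) cardsC.
pose g y := if y \in A then f y else nth y cB (index y cA).
have idx y : y \notin A -> (index y cA < size cB)%N.
  by move=> yA; rewrite -sz index_mem mem_enum inE.
have gout y : y \notin A -> g y \notin f @: A.
  move=> yA; rewrite /g (negPf yA).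
  by have := mem_nth y (idx _ yA); rewrite mem_enum inE.
have gin y : y \in A -> g y \in f @: A by move=> yA; rewrite /g yA imset_f.
have injg : injective g.
  move=> y z E; case: (boolP (y \in A)) (boolP (z \in A)) => yA [] zA.
  - by move: E; rewrite /g yA zA; exact: injf.
  - by have := gout _ zA; rewrite -E gin.
  - by have := gout _ yA; rewrite E gin.
  - move: E; rewrite /g (negPf yA) (negPf zA) (set_nth_default z) ?idx // => /eqP.
    rewrite nth_uniq ?idx ?enum_uniq // => /eqP.
    by apply: (index_inj y); rewrite mem_enum inE.
by exists (perm injg) => y yA; rewrite permE /g yA.
Qed.

(** [f] is injective on the set [A] where [g] undoes it. If [f (g y) = y], then [g y] lies in [A],
    which settles the inverse. *)
Lemma perm_of_near_inverse (Y : finType) (f g : Y -> Y) : exists s : {perm Y},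
  (forall y, g (f y) = y -> s y = f y) /\ (forall y, f (g y) = y -> (s^-1)%g y = g y).
Proof.
pose A : {set Y} := finset (fun y => g (f y) == y).
have [|s sf] := @perm_extension Y A f.
  by move=> y z; rewrite !inE => /eqP {2}<- /eqP {2}<- ->.
exists s; split=> y E; first by apply: sf; rewrite inE E.
by apply: (@perm_inj _ s); rewrite permKV sf ?E // inE E.
Qed.

(** * Transfer of soficity *)

(** One [eta] pays for the inner move; the other pays for the outer move, through a bad set pulled
    back along the exact inner move. *)
Lemma small_rule_inverse (R : realType) (mu : probability Xspace R)
    (act act' : nat -> bool -> Xspace -> Xspace) (eta : R) (i : nat) (b : bool) :
  mp_borel_action mu act ->
  (forall i b, small mu eta [set x | act' i b x <> act i b x]) ->
  small mu (eta + eta) [set x | act' i b (act' i (~~ b) x) <> x].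
Proof.
move=> mp close.
have [_ Smono SU inv] := small_smallness i.+1 mp.
apply: Smono (SU _ _ _ _ (close i (~~ b)) (inv i (~~ b) _ _ (ltnSn i) (close i b))) => //.
move=> x /= ne; have [E|] := pselect (act' i (~~ b) x = act i (~~ b) x); last by left.
right; rewrite -E => E'; apply: ne; rewrite E' E.
by rewrite -[b in act i b]negbK (act_letterK i (~~ b) mp.1).
Qed.

(** For given radius and error, a single finite model serves all local [Q]: it is obtained by
    controlling whole profiles of the ball tests, of which there are finitely many. *)
Lemma sofic_transfer (R : realType) (mu : probability Xspace R)
    (act1 act2 : nat -> bool -> Xspace -> Xspace) (N : nat) (eps : R) :
  mp_borel_action mu act1 -> mp_borel_action mu act2 ->
  {ae mu, forall x, F_orbit act1 x = F_orbit act2 x} ->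
  sofic mu act1 -> 0 < eps ->
  exists (Y : finType) (lab : Y -> nat -> bool) (s : nat -> {perm Y}),
    forall Q : local_statistic, is_local N Q ->
      `|freq R (Q Y (perm_act s) lab) - fine (mu [set x | Q _ act2 id x])| <= eps.
Proof.
move=> mp1 mp2 ae [Y [lab [s cv]]] e0.
pose K := ball_tests N; pose C : R := (\sum_(k <- K) cost k)%:R.
have C0 : 0 <= C by rewrite /C ler0n.
have C4 : 0 < C *+ 4 + 1 by rewrite ltr_wpDl // mulrn_wge0.
(* The error budget is [C * (3 eta)] for passing from rules to permutations, [eta] for convergence
   of frequencies, and [C * eta] for replacing [act2] by its rule on [Xspace]. *)
pose eta := eps / (C *+ 4 + 1).
have eta0 : 0 < eta by rewrite divr_gt0.
have etaE : C * (eta + eta + eta) + eta + C * eta = eps.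
  by rewrite -[RHS](divfK (lt0r_neq0 C4)) -/eta; ring.
have /choice[D' hD'] : forall a : nat * bool, exists D, finitary_rule D /\
    small mu eta [set x | act_word act1 (D x) x <> act2 a.1 a.2 x].
  move=> [i b]; apply: finitary_rule_exists => //; first by have [] := mp2.2 i b.
  apply: filterS ae => x ->; by exists [:: (i, b)].
pose D i b := D' (i, b).
have finD i b : finitary_rule (D i b) by have [] := hD' (i, b).
pose F := rule_act D act1 id.
have closeX i b : small mu eta [set x | F i b x <> act2 i b x] by have [] := hD' (i, b).
pose G n := rule_act D (perm_act (s n)) (lab n).
have near_local r Q : (0 < r)%N -> is_local r Q -> \forall n \near \oo,
    `|fine (mu [set x | Q _ act1 id x]) - freq R (Q (Y n) (perm_act (s n)) (lab n))| <= eta.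
  move=> r0 lQ; have := sofic_local_cvg mp1 (fun alpha => cv r alpha r0) lQ.
  by move/cvgrPdist_le; apply.
have [r r0 locK] := rule_profile_local finD K.
(* Only finitely many sets [A] of profiles exist, so one index can serve them all. *)
have near_profile : \forall n \near \oo, forall A : {set (size K).-tuple bool},
    `|fine (mu [set x | profile F id K x \in map val (enum A)]) -
      freq R [set y | profile (G n) (lab n) K y \in map val (enum A)]| <= eta.
  by apply: filter_forall => A; exact: near_local r0 (locK (fun t => t \in map val (enum A))).
(* On [Xspace] the rules fail to be inverse on measure at most [2 eta]; convergence of frequencies
   adds the third [eta]. Generators below [N] are the only ones occurring in [K]. *)
have near_inverse : \forall n \near \oo, forall a : 'I_N * bool,
    freq R [set y | G n a.1 a.2 (G n a.1 (~~ a.2) y) <> y] <= eta + eta + eta.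
  apply: filter_forall => -[i b] /=.
  pose k : test := inl ([:: (i : nat, b); (i : nat, ~~ b)], [::]).
  have [q q0 lock] := rule_profile_local finD [:: k].
  have kE (Z : Type) (H : nat -> bool -> Z -> Z) l z :
      profile H l [:: k] z = [:: false] <-> H i b (H i (~~ b) z) <> z.
    by rewrite /profile /=; split=> [[/negbT/asboolPn]|/asboolPn/negPf ->].
  have kF : [set x | profile F id [:: k] x = [:: false]] = [set x | F i b (F i (~~ b) x) <> x].
    by apply/seteqP; split=> x; [exact: (kE _ F id x).1|exact: (kE _ F id x).2].
  have mS : measurable [set x | F i b (F i (~~ b) x) <> x].
    by rewrite -kF; exact: measurable_local mp1 (lock (fun t => t = [:: false])).
  have := near_local _ _ q0 (lock (fun t => t = [:: false])).
  apply: filterS => n.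
  rewrite (@freq_eq _ _ _ [set y | G n i b (G n i (~~ b) y) <> y]); last by move=> y; exact: kE.
  rewrite [X in mu X]kF.
  rewrite distrC => /ler_normlW; rewrite lerBlDr => h; apply: le_trans h _.
  rewrite [leRHS]addrC lerD2l.
  have [B [mB sub muB]] := small_rule_inverse i b mp2 closeX.
  rewrite -lee_fin fineK; last exact: (fin_num_measure mu).
  by apply: le_trans muB; apply: le_measure => //; exact: mem_set.
have [n [hprof hinv]] := filter_ex (filterI near_profile near_inverse).
(* The permutation for generator [i] follows the rules wherever they are mutually inverse. *)
have /choice[t ht] := fun i => perm_of_near_inverse (G n i true) (G n i false).
exists (Y n), (lab n), t => Q lQ.
have smallY := freq_smallness R N t.
have closeY i b : (i < N)%N ->
    freq R [set y | G n i b y <> perm_act t i b y] <= eta + eta + eta.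
  move=> iN; have := hinv (Ordinal iN, ~~ b); apply: le_trans; apply: freq_le => y /= ne E.
  by apply: ne; have [t1 t2] := ht i; case: b E => /= E; rewrite /perm_act ?t1 ?t2.
have pertY := perturb_profile (lab n) smallY closeY (fun k kN => kN).
have pertX := perturb_profile id (small_smallness N mp2)
  (fun i b _ => closeX i b) (fun k kN => kN).
(* [A] encodes [Q] as a set of profiles, so that the bounds uniform in such sets apply. *)
pose A := finset (fun u : (size K).-tuple bool => `[< realized N Q (val u) >]).
have AE (Z : Type) (H : nat -> bool -> Z -> Z) l z :
    profile H l K z \in map val (enum A) <-> realized N Q (profile H l K z).
  split=> [/mapP[u]|q]; first by rewrite mem_enum inE => /asboolP + ->.
  apply/mapP; exists (map_tuple (passes H l z) (in_tuple K)) => //.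
  by rewrite mem_enum inE; apply/asboolP.
have QE (Z : Type) (H : nat -> bool -> Z -> Z) l z : is_action H ->
    Q Z H l z <-> profile H l K z \in map val (enum A).
  by move=> hH; rewrite AE; exact: is_localE.
rewrite (@freq_eq _ _ _ [set y | profile (perm_act t) (lab n) K y \in map val (enum A)]);
  last by move=> y; apply: QE; exact: perm_act_action.
rewrite (_ : mkset _ = [set x | profile act2 id K x \in map val (enum A)]); last first.
  by apply/seteqP; split=> x /= /(QE _ _ _ _ mp2.1).
have dY : `|freq R [set y | profile (perm_act t) (lab n) K y \in map val (enum A)] -
    freq R [set y | profile (G n) (lab n) K y \in map val (enum A)]| <= C * (eta + eta + eta).
  apply: freq_dist; apply: le_trans pertY; apply: freq_le => y /= ne E.
  by apply: ne; rewrite E.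
have dX : `|fine (mu [set x | profile F id K x \in map val (enum A)]) -
    fine (mu [set x | profile act2 id K x \in map val (enum A)])| <= C * eta.
  apply: small_dist.
  - exact: measurable_local mp1 (locK (fun t => t \in map val (enum A))).
  - exact: (measurable_profile K (fun t => t \in map val (enum A)) mp2).
  - by apply: small_sub pertX => // x /= ne E; apply: ne; rewrite E.
rewrite -etaE -addrA.
(* The comparison runs from the permutations to the rules on the finite model, then to the rules on
   [Xspace], then to [act2]. *)
apply: le_trans (ler_distD (freq R [set y | profile (G n) (lab n) K y \in map val (enum A)]) _ _) _.
rewrite lerD //.
apply: le_trans (ler_distD (fine (mu [set x | profile F id K x \in map val (enum A)])) _ _) _.
by rewrite lerD // distrC.
Qed.

Theorem theorem2p1 (R : realType) (mu : probability Xspace R)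
    (theta1 theta2 : nat -> bool -> Xspace -> Xspace) :
  is_coin_product mu ->
  mp_borel_action mu theta1 ->
  mp_borel_action mu theta2 ->
  {ae mu, forall x, F_orbit theta1 x = F_orbit theta2 x} ->
  sofic mu theta1 -> sofic mu theta2.
Proof.
move=> _ mp1 mp2 ae sof.
(* The [n]-th model has radius [n] and error [1/(n+1)]; a pattern of radius [r] is controlled as
   soon as [r <= n]. *)
have /choice[M hM] : forall n : nat,
    exists M : {Y : finType & ((Y -> nat -> bool) * (nat -> {perm Y}))%type},
    forall Q : local_statistic, is_local n Q ->
      `|freq R (Q (projT1 M) (perm_act (projT2 M).2) (projT2 M).1) -
        fine (mu [set x | Q _ theta2 id x])| <= n.+1%:R^-1.
  move=> n; have e0 : (0 : R) < n.+1%:R^-1 by rewrite invr_gt0 ltr0n.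
  have [Y [lab [s h]]] := sofic_transfer n mp1 mp2 ae sof e0.
  by exists (existT _ Y (lab, s)).
exists (fun n => projT1 (M n)), (fun n => (projT2 (M n)).1), (fun n => (projT2 (M n)).2).
move=> r alpha r1.
have loc := @nbhd_iso_local r alpha.
have fm := fin_num_measure mu _ (measurable_local mp2 loc).
rewrite -(fineK fm); apply: cvg_EFin; first exact: nearW.
apply/cvgrPdist_le => e e0.
near=> n.
rewrite /= p_finE distrC.
apply: le_trans (hM n _ (is_local_mono _ loc)) _; first by near: n; exact: nbhs_infty_ge.
by apply/ltW; near: n; exact: near_infty_natSinv_lt (PosNum e0).
Unshelve. all: by end_near.
Qed.
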